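(* Let $\mathcal{C}=\{[X_0,X_1,X_2,X_3]\in\mathbb{CP}^3:\ X_0X_3^2+X_1^2X_2=0\}$ and let $\Sigma=Disc(\mathcal{C})\subset\mathbb{S}^4$ be its twistor discriminant locus. Then the manifold $\mathbb{S}^4\setminus\Sigma$ admits $3$ non-constant strongly independent orthogonal complex structures.
   Context: Let $\mathbb{H}$ be the quaternions with basis $1,i,j,k$. The left quaternionic projective line $\mathbb{HP}^1$ is the set of classes $[q_1,q_2]\sim[pq_1,pq_2]$, $p\in\mathbb{H}\setminus\{0\}$. One identifies $\mathbb{S}^4\simeq\mathbb{HP}^1=\mathbb{H}\cup\{\infty\}$ via $q\mapsto[1,q]$, $\infty=[0,1]$. The twistor fibration is $\pi:\mathbb{CP}^3\to\mathbb{HP}^1$, $\pi[X_0,X_1,X_2,X_3]=[X_0+X_1j,\,X_2+X_3j]$ with $X_0,\dots,X_3\in\mathbb{C}_i=\mathbb{R}+\mathbb{R}i\cong\mathbb{C}$. For an algebraic surface $\mathcal{S}\subset\mathbb{CP}^3$ of degree $d$, the twistor discriminant locus is $Disc(\mathcal{S})=\{p\in\mathbb{S}^4:\ \#(\pi^{-1}(p)\cap\mathcal{S})\neq d\}$ (here $d=3$; one has $\infty\in\Sigma$, so $\mathbb{S}^4\setminus\Sigma\subset\mathbb{H}\cong\mathbb{R}^4$). An orthogonal complex structure (OCS) on a Riemannian manifold $(M,g)$ is an integrable complex structure compatible with $g$ (Hermitian); OCS's are taken to be orientation preserving. Orthogonality depends only on the conformal class of $g$. Two OCS's $J_1,J_2$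 on $M$ are strongly independent if $J_1(x)\neq\pm J_2(x)$ for every $x\in M$; a family of OCS's is strongly independent if its members are pairwise so. An OCS on an open subset of $\mathbb{H}\cong\mathbb{R}^4$ is constant if, under the identification of all tangent spaces with $\mathbb{R}^4$, it does not depend on the point. *)

(* Defs.v *)
From HB Require Import structures.
From mathcomp Require Import all_boot all_order all_algebra.
From mathcomp Require Import generic_quotient complex ring lra.
From mathcomp Require Import all_classical all_reals all_analysis.

Set Implicit Arguments.
Unset Strict Implicit.
Unset Printing Implicit Defensive.

Import Order.TTheory GRing.Theory Num.Theory.
Import numFieldNormedType.Exports.

Local Open Scope classical_set_scope.
Local Open Scope ring_scope.
Local Open Scope quotient_scope.
Local Open Scope complex_scope.

(* Quaternions are row vectors of coordinates in the basis (1, i, j, k), so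
   that H is, as a normed space, literally R^4. *)
Notation quat R := 'rV[R]_4.

Definition mkquat (R : realType) (a b c d : R) : quat R :=
  \row_(t < 4) [:: a; b; c; d]`_t.

Lemma mkquatE (R : realType) (a b c d : R) :
  (mkquat a b c d 0 0 = a) * (mkquat a b c d 0 1 = b) *
  (mkquat a b c d 0 2 = c) * (mkquat a b c d 0 3 = d).
Proof. by rewrite !mxE. Qed.

Lemma quatP (R : realType) (p q : quat R) :
  p 0 0 = q 0 0 -> p 0 1 = q 0 1 -> p 0 2 = q 0 2 -> p 0 3 = q 0 3 -> p = q.
Proof.
move=> h0 h1 h2 h3; apply/rowP => -[[|[|[|[|//]]]] lt4];
  [move: h0|move: h1|move: h2|move: h3];
  by congr (p _ _ = q _ _); apply: val_inj.
Qed.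

Definition qmul (R : realType) (p q : quat R) : quat R :=
  mkquat (p 0 0 * q 0 0 - p 0 1 * q 0 1 - p 0 2 * q 0 2 - p 0 3 * q 0 3)
         (p 0 0 * q 0 1 + p 0 1 * q 0 0 + p 0 2 * q 0 3 - p 0 3 * q 0 2)
         (p 0 0 * q 0 2 - p 0 1 * q 0 3 + p 0 2 * q 0 0 + p 0 3 * q 0 1)
         (p 0 0 * q 0 3 + p 0 1 * q 0 2 - p 0 2 * q 0 1 + p 0 3 * q 0 0).

Definition qone (R : realType) : quat R := mkquat 1 0 0 0.

Lemma qmulA (R : realType) (p q r : quat R) :
  qmul p (qmul q r) = qmul (qmul p q) r.
Proof. by apply: quatP; rewrite /qmul !mkquatE; ring. Qed.

Lemma qmul1 (R : realType) (q : quat R) : qmul (qone R) q = q.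
Proof. by apply: quatP; rewrite /qmul /qone !mkquatE; ring. Qed.

Lemma qmulq0 (R : realType) (q : quat R) : qmul q 0 = 0.
Proof. by apply: quatP; rewrite /qmul !mkquatE !mxE; ring. Qed.

Lemma qone_neq0 (R : realType) : qone R != 0.
Proof.
apply/eqP => /rowP /(_ 0).
by rewrite /qone mkquatE mxE => /eqP; rewrite oner_eq0.
Qed.

Lemma qmul_linv (R : realType) (p : quat R) :
  p != 0 -> exists2 r, r != 0 & qmul r p = qone R.
Proof.
move=> p0; set n := p 0 0 ^+ 2 + p 0 1 ^+ 2 + p 0 2 ^+ 2 + p 0 3 ^+ 2.
have n0 : n != 0.
  apply: contra_neq p0; rewrite /n => n0.
  have [] : [/\ p 0 0 ^+ 2 = 0, p 0 1 ^+ 2 = 0, p 0 2 ^+ 2 = 0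
             & p 0 3 ^+ 2 = 0].
    have := (sqr_ge0 (p 0 0), sqr_ge0 (p 0 1), sqr_ge0 (p 0 2),
             sqr_ge0 (p 0 3)).
    by case=> [[[? ?] ?] ?]; split; lra.
  do 4! (move=> /eqP; rewrite sqrf_eq0 => /eqP ?).
  by apply: quatP; rewrite mxE.
pose r := mkquat (p 0 0 / n) (- p 0 1 / n) (- p 0 2 / n) (- p 0 3 / n).
have rp : qmul r p = qone R.
  by apply: quatP; rewrite /qmul /qone /r !mkquatE /n; field.
exists r => //; apply/eqP => r0; move: rp; rewrite r0.
have -> : qmul 0 p = 0 by apply: quatP; rewrite /qmul !mkquatE !mxE; ring.
by move=> /esym/eqP; rewrite (negPf (qone_neq0 R)).
Qed.

(* z + w j, for z, w in C_i = R + R i. *)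
Definition quatC (R : realType) (z w : R[i]) : quat R :=
  mkquat (complex.Re z) (complex.Im z) (complex.Re w) (complex.Im w).

Lemma quatC_eq0 (R : realType) (z w : R[i]) :
  quatC z w = 0 -> z = 0 /\ w = 0.
Proof.
move=> /rowP zw0.
have := (zw0 0, zw0 1, zw0 2, zw0 3).
rewrite /quatC !mkquatE !mxE; case: z w {zw0} => [a b] [c d] /=.
by case=> -[[-> ->] ->] ->.
Qed.

Lemma quatCM (R : realType) (a z w : R[i]) :
  quatC (a * z) (a * w) = qmul (quatC a 0) (quatC z w).
Proof.
by case: a z w => [a a'] [z z'] [w w']; apply: quatP;
  rewrite /quatC /qmul !mkquatE /=; ring.
Qed.

Notation cvec R := {X : 'rV[R[i]]_4 | X != 0}.

Definition cp3_rel (R : realType) : rel (cvec R) :=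
  fun X Y => `[< exists2 a : R[i], a != 0 & val Y = a *: val X >].

Lemma cp3_rel_refl (R : realType) : reflexive (@cp3_rel R).
Proof. by move=> X; apply/asboolP; exists 1; rewrite ?oner_neq0 ?scale1r. Qed.

Lemma cp3_rel_sym (R : realType) : symmetric (@cp3_rel R).
Proof.
suff h X Y : @cp3_rel R X Y -> cp3_rel Y X by move=> X Y; apply/idP/idP; exact: h.
move=> /asboolP[a a0 XY]; apply/asboolP; exists a^-1; first by rewrite invr_eq0.
by rewrite XY scalerA mulVf // scale1r.
Qed.

Lemma cp3_rel_trans (R : realType) : transitive (@cp3_rel R).
Proof.
move=> Y X Z /asboolP[a a0 YX] /asboolP[b b0 ZY]; apply/asboolP.
by exists (b * a); rewrite ?mulf_neq0// ZY YX scalerA.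
Qed.

Canonical cp3_equiv (R : realType) :=
  EquivRel (@cp3_rel R) (@cp3_rel_refl R) (@cp3_rel_sym R) (@cp3_rel_trans R).

Definition CP3 (R : realType) : Type := {eq_quot cp3_equiv R}.
HB.instance Definition _ (R : realType) :=
  EqQuotient.copy (CP3 R) {eq_quot cp3_equiv R}.

Notation qpair R := {w : quat R * quat R | w != 0}.

Definition hp1_rel (R : realType) : rel (qpair R) :=
  fun v w => `[< exists2 p : quat R, p != 0 &
    val w = (qmul p (val v).1, qmul p (val v).2) >].

Lemma hp1_rel_refl (R : realType) : reflexive (@hp1_rel R).
Proof.
move=> w; apply/asboolP; exists (qone R); first exact: qone_neq0.
by rewrite !qmul1; case: (val w).
Qed.

Lemma hp1_rel_sym (R : realType) : symmetric (@hp1_rel R).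
Proof.
suff h v w : @hp1_rel R v w -> hp1_rel w v by move=> v w; apply/idP/idP; exact: h.
move=> /asboolP[p p0 vw]; apply/asboolP.
have [r r0 rp] := qmul_linv p0; exists r => //.
by rewrite vw /= !qmulA rp !qmul1; case: (val v).
Qed.

Lemma hp1_rel_trans (R : realType) : transitive (@hp1_rel R).
Proof.
move=> v u w /asboolP[p p0 uv] /asboolP[r r0 wu]; apply/asboolP.
exists (qmul r p); last by rewrite wu uv /= !qmulA.
have [s s0 sr] := qmul_linv r0.
apply: contra_neq p0 => rp0.
by rewrite -[p]qmul1 -sr -qmulA rp0 qmulq0.
Qed.

Canonical hp1_equiv (R : realType) :=
  EquivRel (@hp1_rel R) (@hp1_rel_refl R) (@hp1_rel_sym R) (@hp1_rel_trans R).

Definition HP1 (R : realType) : Type := {eq_quot hp1_equiv R}.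
HB.instance Definition _ (R : realType) :=
  EqQuotient.copy (HP1 R) {eq_quot hp1_equiv R}.

Lemma hp1_affine_subproof (R : realType) (q : quat R) : (qone R, q) != 0.
Proof. by apply: contra_neq (qone_neq0 R) => -[]. Qed.

Lemma hp1_infty_subproof (R : realType) : ((0 : quat R), qone R) != 0.
Proof. by apply: contra_neq (qone_neq0 R) => -[]. Qed.

Definition hp1_affine (R : realType) (q : quat R) : HP1 R :=
  \pi_(HP1 R) (exist _ (qone R, q) (hp1_affine_subproof q)).

Definition hp1_infty (R : realType) : HP1 R :=
  \pi_(HP1 R) (exist _ (0, qone R) (hp1_infty_subproof R)).

Lemma hp1P (R : realType) (p : HP1 R) :
  p = hp1_infty R \/ exists q, p = hp1_affine q.
Proof.
elim/quotW: p => -[[a b] ab0].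
have [a0|a0] := eqVneq a 0; [left|right].
  have b0 : b != 0 by apply: contra_neq ab0 => b0; rewrite a0 b0.
  have [r r0 rb] := qmul_linv b0.
  by apply/eqmodP/asboolP; exists r => //=; rewrite a0 qmulq0 rb.
have [r r0 ra] := qmul_linv a0; exists (qmul r b).
by apply/eqmodP/asboolP; exists r => //=; rewrite ra.
Qed.

Definition twistor_vec (R : realType) (X : 'rV[R[i]]_4) : quat R * quat R :=
  (quatC (X 0 0) (X 0 1), quatC (X 0 2) (X 0 3)).

Lemma twistor_vec_neq0 (R : realType) (X : cvec R) : twistor_vec (val X) != 0.
Proof.
apply: contra_neq (valP X) => -[] /quatC_eq0[h0 h1] /quatC_eq0[h2 h3].
apply/rowP => -[[|[|[|[|//]]]] lt4]; rewrite !mxE;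
  [move: h0|move: h1|move: h2|move: h3];
  by congr (val X _ _ = 0); apply: val_inj.
Qed.

Definition twistor (R : realType) (x : CP3 R) : HP1 R :=
  \pi_(HP1 R) (exist _ (twistor_vec (val (repr x))) (twistor_vec_neq0 (repr x))).

Lemma twistor_pi (R : realType) (X : cvec R) :
  twistor (\pi_(CP3 R) X) =
  \pi_(HP1 R) (exist _ (twistor_vec (val X)) (twistor_vec_neq0 X)).
Proof.
rewrite /twistor; apply/eqmodP; rewrite /= hp1_rel_sym.
have /eqmodP : \pi_(CP3 R) X = \pi_(CP3 R) (repr (\pi_(CP3 R) X)).
  by rewrite reprK.
move=> /asboolP[a a0 Xa]; apply/asboolP; exists (quatC a 0).
  by apply: contra_neq a0 => /quatC_eq0[].
by rewrite /= Xa /twistor_vec !mxE !quatCM.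
Qed.

Definition Disc (R : realType) (d : nat) (S : set (CP3 R)) : set (HP1 R) :=
  [set p | ~ ((@twistor R @^-1` [set p] `&` S) #= `I_d)%card].

Definition cubic_scroll (R : realType) : set (CP3 R) :=
  (\pi_(CP3 R)) @` [set X : cvec R |
    (val X) 0 0 * (val X) 0 3 ^+ 2 + (val X) 0 1 ^+ 2 * (val X) 0 2 = 0].

(* The part of S^4 minus Sigma in the affine chart H; by Disc_complE below this
   is all of it. *)
Definition scroll_domain (R : realType) : set (quat R) :=
  @hp1_affine R @^-1` ~` Disc 3 (@cubic_scroll R).

Lemma infty_Disc (R : realType) : Disc 3 (@cubic_scroll R) (hp1_infty R).
Proof.
rewrite /Disc /= => fibre3.
pose X n : 'rV[R[i]]_4 := \row_(t < 4) [:: 0; 0; 1; n%:R]`_t.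
have X0 n : X n != 0.
  by apply/eqP => /rowP/(_ 2); rewrite !mxE /= => /eqP; rewrite oner_eq0.
pose f n : CP3 R := \pi_(CP3 R) (exist _ (X n) (X0 n)).
have f_inj : injective f.
  move=> m n /eqmodP/asboolP[a a0 /=] /rowP eqX.
  have := (eqX 2, eqX 3); rewrite !mxE /= mulr1 => -[<-].
  by rewrite mul1r => /eqP; rewrite eqr_nat => /eqP.
apply: infinite_nat.
suff <- : f @^-1` (@twistor R @^-1` [set hp1_infty R] `&` @cubic_scroll R)
          = setT.
  apply: finite_preimage; first by move=> ? ? _ _; exact: f_inj.
  by apply/finite_setP; exists 3.
apply/seteqP; split => // n _ /=; split; last first.
  by exists (exist _ (X n) (X0 n)) => //=; rewrite !mxE /=; ring.
rewrite /f twistor_pi; apply/esym/eqmodP/asboolP.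
exists (quatC 1 n%:R).
  by apply/eqP => /quatC_eq0[] /eqP; rewrite oner_eq0.
rewrite /twistor_vec /= !mxE /= qmulq0; congr pair; apply: quatP;
  by rewrite /quatC /qmul /qone ?mkquatE ?mxE //=; ring.
Qed.

Lemma Disc_complE (R : realType) :
  ~` Disc 3 (@cubic_scroll R) = @hp1_affine R @` @scroll_domain R.
Proof.
apply/seteqP; split=> [p pD|_ [q qD <-] //].
have [pinf|[q pq]] := hp1P p; last by exists q; rewrite // /scroll_domain /= -pq.
by case: pD; rewrite pinf; exact: infty_Disc.
Qed.

(* C^n on an open set U; only meaningful when U is open. *)
Fixpoint Cn_on (R : realType) (V W : normedModType R) (n : nat) (U : set V)
    (f : V -> W) : Prop :=
  if n is n'.+1 then
    (forall x, U x -> differentiable f x) /\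
    (forall v, Cn_on n' U (fun x => 'D_v f x))
  else forall x, U x -> {for x, continuous f}.

Definition smooth_on (R : realType) (V W : normedModType R) (U : set V)
  (f : V -> W) : Prop := forall n, Cn_on n U f.

(* Multiplication by i on C^2, identified with R^4 by
   (x0 + i x1, x2 + i x3) = (x0, x1, x2, x3). *)
Definition mulI_C2 (R : realType) (v : 'rV[R]_4) : 'rV[R]_4 :=
  mkquat (- v 0 1) (v 0 0) (- v 0 3) (v 0 2).

(* A field of endomorphisms J of R^4 acts on a tangent (row) vector v at x by
   v *m J x.  A holomorphic chart for J at x is a smooth diffeomorphism phi from
   an open neighbourhood A of x onto an open subset of C^2 which turns J into
   multiplication by i. *)
Definition holomorphic_chart (R : realType) (J : 'rV[R]_4 -> 'M[R]_4)
    (A : set 'rV[R]_4) (phi : 'rV[R]_4 -> 'rV[R]_4) : Prop :=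
  [/\ open A /\ open (phi @` A),
      smooth_on A phi,
      exists2 psi : 'rV[R]_4 -> 'rV[R]_4,
        smooth_on (phi @` A) psi & forall y, A y -> psi (phi y) = y
    & forall y v, A y -> 'D_(v *m J y) phi y = mulI_C2 ('D_v phi y)].

Definition integrable_on (R : realType) (U : set 'rV[R]_4)
    (J : 'rV[R]_4 -> 'M[R]_4) : Prop :=
  forall x, U x ->
    exists A phi, [/\ A x, A `<=` U & holomorphic_chart J A phi].

(* The rows v, Jv, w, Jw; complex bases of this shape define the orientation
   induced by J. *)
Definition complex_frame (R : realType) (J : 'M[R]_4) (v w : 'rV[R]_4) :
    'M[R]_4 :=
  \matrix_(t < 4) [:: v; v *m J; w; w *m J]`_t.

(* Orthogonality is with respect to the Euclidean metric, which is conformal to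
   the round metric of S^4 in the chart hp1_affine. *)
Record OCS (R : realType) (U : set 'rV[R]_4) (J : 'rV[R]_4 -> 'M[R]_4) : Prop := {
  OCS_smooth : smooth_on U J;
  OCS_square : forall x, U x -> J x *m J x = - 1%:M;
  OCS_orthogonal : forall x, U x -> J x *m (J x)^T = 1%:M;
  OCS_oriented : forall x, U x -> forall v w,
    complex_frame (J x) v w \in unitmx -> 0 < \det (complex_frame (J x) v w);
  OCS_integrable : integrable_on U J }.

Definition constant_on (R : realType) (U : set 'rV[R]_4)
    (J : 'rV[R]_4 -> 'M[R]_4) : Prop :=
  exists A, forall x, U x -> J x = A.

Definition strongly_independent (R : realType) (U : set 'rV[R]_4)
    (J1 J2 : 'rV[R]_4 -> 'M[R]_4) : Prop :=
  forall x, U x -> J1 x <> J2 x /\ J1 x <> - J2 x.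

(* Main.v *)
Require Import Defs.
From mathcomp Require Import all_boot all_order all_algebra.
From mathcomp Require Import generic_quotient finmap complex ring.
From mathcomp Require Import all_classical all_reals all_analysis.

Set Implicit Arguments.
Unset Strict Implicit.
Unset Printing Implicit Defensive.

Import Order.TTheory GRing.Theory Num.Theory.
Import numFieldNormedType.Exports.

Local Open Scope classical_set_scope.
Local Open Scope ring_scope.
Local Open Scope complex_scope.

(** The discriminant locus contains the 2-sphere made of infinity and the plane
    of all q = a + b j with b = 0.  Indeed, writing a point of the twistor line
    over q as [x, y, a x - b^* y, b x + a^* y], the cubic restricts to the
    binary form
      - b^* y^3 + (a + a^*^2) x y^2 + 2 a^* b x^2 y + b^2 x^3,
    which for b = 0 is (a + a^*^2) x y^2: it then has a double root or vanishes.
    Hence the domain lies off that plane, and any structures that live off the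
    plane and are independent there will do.

    For a real t let I_t(q) be the imaginary part of q - t i divided by its
    norm.  It is defined off the line of all x + t i with x real, which lies in
    the plane.  Left multiplication by I_t(q) is orthogonal and compatible with
    the orientation, as is left multiplication by any imaginary unit, and it is
    integrable (slice_J_OCS): the real part of q together with the distance from
    q to the line, and the stereographic coordinate of I_t(q) on the sphere of
    imaginary units, are complex coordinates, valid on all of the complement of
    the plane (slice_chart_holomorphic).  For s <> t the imaginary parts of
    q - s i and q - t i differ by a nonzero multiple of i, so they are
    proportional only when b = 0; this is strong independence
    (slice_J_independent).  The values t = 0, 1, 2 give the three structures.

    It remains to know the domain well enough to see that it is open and that
    the structures vary on it.  By scroll_domainP it is the set where the
    discriminant of the binary form does not vanish, an open condition
    satisfied at j and - j, where each I_t takes two different values.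

    The structures cannot be read off the three sheets of the cubic over the
    domain: two of these are exchanged along a small loop around a generic point
    of the discriminant locus with b <> 0. *)

(** * Smooth functions *)

Section SmoothCalculus.
Context {R : realType} {V : normedModType R}.
Implicit Types (W : normedModType R) (U : set V).

(** The rules of differentiation hold only on [U], so higher derivatives are
    known only on [U]; this makes that enough on an open set. *)
Lemma near_eq_differentiable W (f g : V -> W) (x : V) :
  (\forall y \near x, f y = g y) -> differentiable f x -> differentiable g x.
Proof.
move=> fg df.
have gE : g \o shift x = cst (g x) + 'd f x +o_ 0 id.
  apply/eqaddoP => e e0.
  have /eqaddoP/(_ e e0) := diff_locally df.
  have : \forall y \near (0 : V), f (y + x) = g (y + x).
    by have := fg; rewrite (near_shift 0) subr0.
  apply: filterS2 => y fgy; rewrite /= !fctE /= fgy.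
  by rewrite (nbhs_singleton fg).
have dg : 'd g x = 'd f x :> (V -> W).
  by apply: diff_unique => //; exact: diff_continuous.
by apply/diff_locallyP; rewrite dg; split => //; exact: diff_continuous.
Qed.

Lemma Cn_on_eq W n U (f g : V -> W) :
  open U -> (forall x, U x -> f x = g x) -> Cn_on n U f -> Cn_on n U g.
Proof.
move=> oU; elim: n f g => [|n IHn] f g fg.
  move=> cf x Ux; have := cf x Ux; rewrite /prop_for /continuous_at -fg//.
  apply: cvg_trans; apply: near_eq_cvg.
  by apply: filterS (open_nbhs_nbhs (conj oU Ux)) => y Uy /=; rewrite fg.
have nfg x : U x -> \forall y \near x, f y = g y.
  by move=> Ux; apply: filterS (open_nbhs_nbhs (conj oU Ux)) => y Uy; rewrite fg.
move=> [df Df]; split=> [x Ux|v].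
  by apply: near_eq_differentiable (nfg x Ux) (df x Ux).
apply: IHn (Df v) => x Ux; exact: near_eq_derive (nfg x Ux).
Qed.

Lemma Cn_on_pred W n U (f : V -> W) : Cn_on n.+1 U f -> Cn_on n U f.
Proof.
elim: n f => [|n IHn] f [df Df]; first by move=> x /df /differentiable_continuous.
by split=> // v; exact: IHn (Df v).
Qed.

Lemma Cn_on_cst W n U (w : W) : Cn_on n U (cst w : V -> W).
Proof.
elim: n w => [|n IHn] w; first by move=> x _; exact: cst_continuous.
split=> [x _|v]; first exact: differentiable_cst.
rewrite (_ : (fun x => _) = cst 0); first exact: IHn.
by apply/funext => x; rewrite derive_cst.
Qed.

Lemma Cn_onD W n U (f g : V -> W) : open U ->
  Cn_on n U f -> Cn_on n U g -> Cn_on n U (fun x => f x + g x).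
Proof.
move=> oU; elim: n f g => [|n IHn] f g.
  by move=> cf cg x Ux; apply: cvgD; [exact: cf|exact: cg].
move=> [df Df] [dg Dg]; split=> [x Ux|v].
  by apply: differentiableD; [exact: df|exact: dg].
apply: Cn_on_eq (IHn _ _ (Df v) (Dg v)) => // x Ux.
by rewrite (deriveD (diff_derivable (df x Ux)) (diff_derivable (dg x Ux))).
Qed.

Lemma Cn_onM n U (f g : V -> R) : open U ->
  Cn_on n U f -> Cn_on n U g -> Cn_on n U (fun x => f x * g x).
Proof.
move=> oU; elim: n f g => [|n IHn] f g.
  by move=> cf cg x Ux; apply: cvgM; [exact: cf|exact: cg].
move=> cf cg; have [df Df] := cf; have [dg Dg] := cg; split=> [x Ux|v].
  by apply: differentiableM; [exact: df|exact: dg].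
apply: Cn_on_eq (Cn_onD oU (IHn _ _ (Cn_on_pred cf) (Dg v))
                          (IHn _ _ (Cn_on_pred cg) (Df v))) => // x Ux.
by rewrite (deriveM (diff_derivable (df x Ux)) (diff_derivable (dg x Ux))).
Qed.

Lemma Cn_onN n U (f : V -> R) : open U ->
  Cn_on n U f -> Cn_on n U (fun x => - f x).
Proof.
move=> oU cf; have := Cn_onM oU (Cn_on_cst n U (-1 : R)) cf.
by apply: Cn_on_eq => // x _; rewrite mulN1r.
Qed.

(** The derivative of [1 / f] is [- (1 / f) ^ 2 * f'], so the induction on the
    order of differentiability feeds on itself; the square root below works the
    same way. *)
Lemma Cn_onV n U (f : V -> R) : open U -> (forall x, U x -> f x != 0) ->
  Cn_on n U f -> Cn_on n U (fun x => (f x)^-1).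
Proof.
move=> oU f0; elim: n => [|n IHn].
  by move=> cf x Ux; apply: cvgV; [exact: f0|exact: cf].
move=> cf; have [df Df] := cf; split=> [x Ux|v].
  by apply: differentiableV; [exact: df|exact: f0].
have cV := IHn (Cn_on_pred cf).
apply: Cn_on_eq (Cn_onN oU (Cn_onM oU (Cn_onM oU cV cV) (Df v))) => // x Ux.
rewrite (deriveV (f0 x Ux) (diff_derivable (df x Ux))).
by rewrite expr2 invfM -mulNr.
Qed.

Lemma is_derive_sqrt (f : V -> R) (x v : V) : 0 < f x -> differentiable f x ->
  is_derive x v (fun y => Num.sqrt (f y)) ((2 * Num.sqrt (f x))^-1 * 'D_v f x).
Proof.
move=> fx0 df.
have [ds Ds] := is_derive1_sqrt fx0.
have ds' : differentiable (Num.sqrt : R -> R) (f x) by exact/derivable1_diffP.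
have dc := differentiable_comp df ds'.
apply: DeriveDef; first exact: (diff_derivable (v := v) dc).
rewrite (deriveE v dc) (diff_comp df ds') /= -(deriveE v df).
rewrite -[X in 'd _ _ X](mulr1 ('D_v f x)).
by rewrite [LHS]linearZ /= -(deriveE _ ds') Ds [RHS]mulrC.
Qed.

Lemma differentiable_sqrt (f : V -> R) (x : V) : 0 < f x ->
  differentiable f x -> differentiable (fun y => Num.sqrt (f y)) x.
Proof.
move=> fx0 df; have [ds _] := is_derive1_sqrt fx0.
by apply: (differentiable_comp df); exact/derivable1_diffP.
Qed.

Lemma Cn_on_sqrt n U (f : V -> R) : open U -> (forall x, U x -> 0 < f x) ->
  Cn_on n U f -> Cn_on n U (fun x => Num.sqrt (f x)).
Proof.
move=> oU f0; elim: n => [|n IHn].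
  move=> cf x Ux; apply: continuous_comp; first exact: cf.
  exact: sqrt_continuous.
move=> cf; have [df Df] := cf; split=> [x Ux|v].
  by apply: differentiable_sqrt; [exact: f0|exact: df].
have s0 x : U x -> 2 * Num.sqrt (f x) != 0.
  by move=> Ux; rewrite mulf_neq0// gt_eqF// sqrtr_gt0 f0.
have cV := Cn_onV oU s0 (Cn_onM oU (Cn_on_cst n U (2 : R)) (IHn (Cn_on_pred cf))).
apply: Cn_on_eq (Cn_onM oU cV (Df v)) => // x Ux.
by have [_ ->] := is_derive_sqrt v (f0 x Ux) (df x Ux).
Qed.

Lemma Cn_onZl W n U (f : V -> R) (w : W) : open U ->
  Cn_on n U f -> Cn_on n U (fun x => f x *: w).
Proof.
move=> oU; elim: n f => [|n IHn] f.
  by move=> cf x Ux; apply: cvgZr_tmp; exact: cf x Ux.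
move=> [df Df]; split=> [x Ux|v]; first by apply: differentiableZl; exact: df.
apply: Cn_on_eq (IHn _ (Df v)) => // x Ux.
rewrite [RHS]deriveE; last by apply: differentiableZl; exact: df.
by rewrite (diffZl _ (df x Ux)) (deriveE _ (df x Ux)).
Qed.

End SmoothCalculus.

Lemma derive_coord (R : realType) m p (M v : 'M[R]_(m.+1, p.+1)) i j :
  'D_v (fun N : 'M[R]_(m.+1, p.+1) => N i j : R) M = v i j.
Proof.
have /matrixP/(_ i j) := derive_mx (@derivable_id _ _ M v).
by rewrite derive_id mxE.
Qed.

Lemma Cn_on_coord (R : realType) m p n (U : set 'M[R]_(m.+1, p.+1)) i j :
  Cn_on n U (fun N : 'M[R]_(m.+1, p.+1) => N i j : R).
Proof.
case: n => [|n]; first by move=> x _; exact: coord_continuous.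
split=> [x _|v]; first exact: differentiable_coord.
rewrite (_ : (fun x => _) = cst (v i j)); first exact: Cn_on_cst.
by apply/funext => x; rewrite derive_coord.
Qed.

Lemma Cn_on_sum (R : realType) (V W : normedModType R) n (U : set V)
    (I : Type) (r : seq I) (f : I -> V -> W) : open U ->
  (forall i, Cn_on n U (f i)) -> Cn_on n U (fun x => \sum_(i <- r) f i x).
Proof.
move=> oU cf; elim: r => [|i r IHr].
  by apply: Cn_on_eq (Cn_on_cst n U 0) => // x _; rewrite big_nil.
by apply: Cn_on_eq (Cn_onD oU (cf i) IHr) => // x _; rewrite big_cons.
Qed.

Lemma Cn_on_mx (R : realType) (V : normedModType R) m p n (U : set V)
    (f : V -> 'M[R]_(m.+1, p.+1)) : open U ->
  (forall i j, Cn_on n U (fun x => f x i j)) -> Cn_on n U f.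
Proof.
move=> oU cf.
have cs : Cn_on n U (fun x => \sum_(i <- enum 'I_m.+1)
    \sum_(j <- enum 'I_p.+1) f x i j *: delta_mx i j).
  by do 2 (apply: Cn_on_sum => // ?); apply: Cn_onZl.
apply: Cn_on_eq cs => // x _; rewrite [RHS]matrix_sum_delta big_enum.
by apply: eq_bigr => i _; rewrite big_enum.
Qed.

Lemma Cn_on_mkquat (R : realType) (V : normedModType R) n (U : set V)
    (a b c d : V -> R) : open U ->
  Cn_on n U a -> Cn_on n U b -> Cn_on n U c -> Cn_on n U d ->
  Cn_on n U (fun x => mkquat (a x) (b x) (c x) (d x)).
Proof.
move=> oU ca cb cc cd; apply: Cn_on_mx => // i j.
rewrite (_ : (fun x => _) = (fun x => [:: a x; b x; c x; d x]`_j)); last first.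
  by apply/funext => x; rewrite mxE.
by case: j => -[|[|[|[|//]]]].
Qed.

(** * Left multiplication by imaginary quaternions *)

Definition lmul_mx (R : realType) (p : quat R) : 'M[R]_4 :=
  \matrix_(i, j) qmul p (delta_mx 0 i) 0 j.

Lemma sum_ord4 (A : nmodType) (f : 'I_4 -> A) :
  \sum_i f i = f 0 + f 1 + f 2 + f 3.
Proof.
rewrite 4!big_ord_recl big_ord0 addr0 !addrA.
by congr (_ + f _ + f _ + f _); apply: val_inj.
Qed.

Lemma mul_lmul_mx (R : realType) (p v : quat R) : v *m lmul_mx p = qmul p v.
Proof.
apply/rowP => j; rewrite mxE sum_ord4 !mxE /=.
by case: j => -[|[|[|[|//]]]] lt4 /=; ring.
Qed.

Lemma det4 (R : comNzRingType) (g : nat -> nat -> R) :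
  \det (\matrix_(i < 4, j < 4) g i j) =
    g 0%N 0%N * (g 1%N 1%N * (g 2%N 2%N * g 3%N 3%N - g 2%N 3%N * g 3%N 2%N)
           - g 1%N 2%N * (g 2%N 1%N * g 3%N 3%N - g 2%N 3%N * g 3%N 1%N)
           + g 1%N 3%N * (g 2%N 1%N * g 3%N 2%N - g 2%N 2%N * g 3%N 1%N))
  - g 0%N 1%N * (g 1%N 0%N * (g 2%N 2%N * g 3%N 3%N - g 2%N 3%N * g 3%N 2%N)
           - g 1%N 2%N * (g 2%N 0%N * g 3%N 3%N - g 2%N 3%N * g 3%N 0%N)
           + g 1%N 3%N * (g 2%N 0%N * g 3%N 2%N - g 2%N 2%N * g 3%N 0%N))
  + g 0%N 2%N * (g 1%N 0%N * (g 2%N 1%N * g 3%N 3%N - g 2%N 3%N * g 3%N 1%N)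
           - g 1%N 1%N * (g 2%N 0%N * g 3%N 3%N - g 2%N 3%N * g 3%N 0%N)
           + g 1%N 3%N * (g 2%N 0%N * g 3%N 1%N - g 2%N 1%N * g 3%N 0%N))
  - g 0%N 3%N * (g 1%N 0%N * (g 2%N 1%N * g 3%N 2%N - g 2%N 2%N * g 3%N 1%N)
           - g 1%N 1%N * (g 2%N 0%N * g 3%N 2%N - g 2%N 2%N * g 3%N 0%N)
           + g 1%N 2%N * (g 2%N 0%N * g 3%N 1%N - g 2%N 1%N * g 3%N 0%N)).
Proof.
do 3! (rewrite !(expand_det_row _ ord0) !big_ord_recl !big_ord0 /cofactor).
rewrite !det_mx11 !mxE /= /bump /= ?(addn0, add0n, add1n).
ring.
Qed.

(** The determinant of [v, p v, w, p w] is the squared norm of the cross product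
    of [p] with [c], the imaginary part of [w] times the conjugate of [v]: right
    multiplication by the conjugate of [v] reduces it to the case [v = 1]. So it
    is never negative, which is compatibility with the orientation. *)
Lemma det_complex_frame (R : realType) (p v w : quat R) : p 0 0 = 0 ->
  let c1 := v 0 0 * w 0 1 - v 0 1 * w 0 0 + v 0 2 * w 0 3 - v 0 3 * w 0 2 in
  let c2 := v 0 0 * w 0 2 - v 0 2 * w 0 0 + v 0 3 * w 0 1 - v 0 1 * w 0 3 in
  let c3 := v 0 0 * w 0 3 - v 0 3 * w 0 0 + v 0 1 * w 0 2 - v 0 2 * w 0 1 in
  \det (complex_frame (lmul_mx p) v w) =
    (p 0 2 * c3 - p 0 3 * c2) ^+ 2 + (p 0 3 * c1 - p 0 1 * c3) ^+ 2
    + (p 0 1 * c2 - p 0 2 * c1) ^+ 2.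
Proof.
move=> p0 c1 c2 c3.
pose coords (q : quat R) := [:: q 0 0; q 0 1; q 0 2; q 0 3].
have -> : complex_frame (lmul_mx p) v w = \matrix_(i < 4, j < 4)
    (nth [::] [:: coords v; coords (qmul p v); coords w; coords (qmul p w)] i)`_j.
  apply/matrixP => i j; rewrite !mxE !mul_lmul_mx.
  by case: i => -[|[|[|[|//]]]] ? /=; case: j => -[|[|[|[|//]]]] ? /=;
    rewrite ?mxE; congr (_ _ _); apply: val_inj.
rewrite (det4 (fun i j => (nth [::] [:: coords v; coords (qmul p v); coords w;
  coords (qmul p w)] i)`_j)) /= !mkquatE p0 /c1 /c2 /c3; ring.
Qed.

Lemma lmul_mx_sqr (R : realType) (p : quat R) : p 0 0 = 0 ->
  p 0 1 ^+ 2 + p 0 2 ^+ 2 + p 0 3 ^+ 2 = 1 -> lmul_mx p *m lmul_mx p = - 1%:M.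
Proof.
move=> p0 p1; apply/row_matrixP => i; rewrite !rowE mulmxA !mul_lmul_mx mulmxN mulmx1.
have n1 : p 0 1 ^+ 2 = 1 - p 0 2 ^+ 2 - p 0 3 ^+ 2 by rewrite -p1; ring.
apply: quatP; rewrite !mkquatE [RHS]mxE p0; ring: n1.
Qed.

Lemma lmul_mx_tr (R : realType) (p : quat R) : p 0 0 = 0 ->
  (lmul_mx p)^T = - lmul_mx p.
Proof.
move=> p0; apply/matrixP => i j; rewrite !mxE /= p0.
by case: i => -[|[|[|[|//]]]] ? /=; case: j => -[|[|[|[|//]]]] ? /=; ring.
Qed.

Lemma lmul_mx_sum (R : realType) (p : quat R) : lmul_mx p =
  p 0 0 *: lmul_mx (delta_mx 0 0) + p 0 1 *: lmul_mx (delta_mx 0 1)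
  + p 0 2 *: lmul_mx (delta_mx 0 2) + p 0 3 *: lmul_mx (delta_mx 0 3).
Proof.
apply/row_matrixP => i; rewrite !linearD !linearZ /= !rowE !mul_lmul_mx.
by apply: quatP; rewrite !(mkquatE, mxE) /=; ring.
Qed.

(** * The slice structures and their charts *)

Definition axis_dist (R : realType) (t : R) (q : quat R) : R :=
  Num.sqrt ((q 0 1 - t) ^+ 2 + q 0 2 ^+ 2 + q 0 3 ^+ 2).

(** The direction from the axis of all [x + t i], [x] real, to [q]. *)
Definition slice_unit (R : realType) (t : R) (q : quat R) : quat R :=
  mkquat 0 ((q 0 1 - t) / axis_dist t q) (q 0 2 / axis_dist t q)
           (q 0 3 / axis_dist t q).

Definition slice_J (R : realType) (t : R) (q : quat R) : 'M[R]_4 :=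
  lmul_mx (slice_unit t q).

(** The complement of the plane of complex numbers [x + y i], which contains
    all the axes. *)
Definition off_plane (R : realType) : set (quat R) :=
  [set q | q 0 2 != 0 \/ q 0 3 != 0].

(** The last two coordinates are the stereographic projection from [- i] of
    [slice_unit t q], which equals [- i] only in the plane. *)
Definition slice_chart (R : realType) (t : R) (q : quat R) : quat R :=
  let m := axis_dist t q + (q 0 1 - t) in
  mkquat (q 0 0) (axis_dist t q) (q 0 2 / m) (q 0 3 / m).

Definition slice_chart_inv (R : realType) (t : R) (y : quat R) : quat R :=
  let s := y 0 2 ^+ 2 + y 0 3 ^+ 2 in
  mkquat (y 0 0) (t + y 0 1 * (1 - s) / (1 + s)) (2 * y 0 1 * y 0 2 / (1 + s))
         (2 * y 0 1 * y 0 3 / (1 + s)).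

Section Slice.
Context {R : realType} (t : R).
Implicit Types (q v w y : quat R) (U : set (quat R)).

Lemma off_plane_gt0 q : off_plane q -> 0 < q 0 2 ^+ 2 + q 0 3 ^+ 2.
Proof.
case=> h; [apply: ltr_pwDl|apply: ltr_pwDr];
  by rewrite ?sqr_ge0// lt_neqAle sqr_ge0 eq_sym sqrf_eq0 h.
Qed.

Lemma axis_sqr_gt0 q : off_plane q ->
  0 < (q 0 1 - t) ^+ 2 + q 0 2 ^+ 2 + q 0 3 ^+ 2.
Proof. by move=> /off_plane_gt0 h; rewrite -addrA ltr_wpDl// sqr_ge0. Qed.

Lemma axis_dist_gt0 q : off_plane q -> 0 < axis_dist t q.
Proof. by move=> /axis_sqr_gt0 h; rewrite sqrtr_gt0. Qed.

Lemma axis_distE q : axis_dist t q ^+ 2 =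
  (q 0 1 - t) ^+ 2 + q 0 2 ^+ 2 + q 0 3 ^+ 2.
Proof. by rewrite sqr_sqrtr// !addr_ge0// sqr_ge0. Qed.

(** Off the plane the distance to the axis strictly exceeds the absolute value of
    its [i]-component. *)
Lemma chart_den_gt0 q : off_plane q -> 0 < axis_dist t q + (q 0 1 - t).
Proof.
move=> qU; have := off_plane_gt0 qU; have := axis_dist_gt0 qU.
have := axis_distE q; set n := axis_dist _ _; set a := q 0 1 - t => n2 n0 s0.
suff : - a < n by rewrite -subr_gt0 opprK.
have [a0|a0] := leP 0 a; first by apply: le_lt_trans n0; rewrite oppr_le0.
have : (- a) ^+ 2 < n ^+ 2 by rewrite sqrrN n2 -addrA ltrDl.
by rewrite ltr_pXn2r// nnegrE ?oppr_ge0 ltW.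
Qed.

Lemma slice_unit_norm q : off_plane q ->
  slice_unit t q 0 1 ^+ 2 + slice_unit t q 0 2 ^+ 2 + slice_unit t q 0 3 ^+ 2 = 1.
Proof.
move=> qU; rewrite /slice_unit !mkquatE !expr_div_n -!mulrDl axis_distE divff//.
by rewrite gt_eqF// axis_sqr_gt0.
Qed.

Lemma slice_chartK q : off_plane q ->
  slice_chart_inv t (slice_chart t q) = q.
Proof.
move=> qU; rewrite /slice_chart /slice_chart_inv !mkquatE.
have m0 := gt_eqF (chart_den_gt0 qU); have n0 := gt_eqF (axis_dist_gt0 qU).
have := axis_distE q; set n := axis_dist _ _; set m := n + _ => n2.
have q1E : q 0 1 = t + m - n by rewrite /m; ring.
(* The square root is eliminated in favour of n and m, in which everything is
   rational. *)
have sE : q 0 2 ^+ 2 + q 0 3 ^+ 2 = m * (2 * n - m).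
  apply/(addrI ((q 0 1 - t) ^+ 2)); rewrite addrA -n2 q1E; ring.
have -> : (q 0 2 / m) ^+ 2 + (q 0 3 / m) ^+ 2 = (2 * n - m) / m.
  by rewrite !expr_div_n -mulrDl sE; field; rewrite m0.
have d0 : 1 + (2 * n - m) / m = 2 * n / m by field; rewrite m0.
by apply: quatP; rewrite !mkquatE ?d0 ?q1E //; field; rewrite m0 n0.
Qed.

Lemma chart_inv_den_gt0 y : 0 < 1 + (y 0 2 ^+ 2 + y 0 3 ^+ 2).
Proof. by rewrite ltr_pwDl// addr_ge0// sqr_ge0. Qed.

Lemma slice_chart_invK y : 0 < y 0 1 -> slice_chart t (slice_chart_inv t y) = y.
Proof.
move=> y1; have s0 := gt_eqF (chart_inv_den_gt0 y).
have dE : axis_dist t (slice_chart_inv t y) = y 0 1.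
  rewrite /axis_dist /slice_chart_inv !mkquatE -[RHS]gtr0_norm// -sqrtr_sqr.
  by congr Num.sqrt; field; rewrite s0.
rewrite /slice_chart dE /slice_chart_inv !mkquatE.
have -> : y 0 1 + (t + y 0 1 * (1 - (y 0 2 ^+ 2 + y 0 3 ^+ 2)) /
    (1 + (y 0 2 ^+ 2 + y 0 3 ^+ 2)) - t) =
    2 * y 0 1 / (1 + (y 0 2 ^+ 2 + y 0 3 ^+ 2)) by field; rewrite s0.
by apply: quatP; rewrite !mkquatE //; field; rewrite s0 gt_eqF.
Qed.

Lemma Cn_on_axis_sqr n U : open U ->
  Cn_on n U (fun q => (q 0 1 - t) ^+ 2 + q 0 2 ^+ 2 + q 0 3 ^+ 2 : R).
Proof.
move=> oU; have cc i := Cn_on_coord n U 0 i.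
have c1 := Cn_onD oU (cc 1) (Cn_on_cst n U (- t)).
exact: (Cn_onD oU (Cn_onD oU (Cn_onM oU c1 c1) (Cn_onM oU (cc 2) (cc 2)))
  (Cn_onM oU (cc 3) (cc 3))).
Qed.

Lemma Cn_on_axis_dist n U : open U -> U `<=` @off_plane R ->
  Cn_on n U (axis_dist t).
Proof.
move=> oU Uoff; apply: Cn_on_sqrt => // [x /Uoff /axis_sqr_gt0 //|].
exact: Cn_on_axis_sqr.
Qed.

Lemma Cn_on_slice_J n U : open U -> U `<=` @off_plane R ->
  Cn_on n U (slice_J t).
Proof.
move=> oU Uoff; have cc i := Cn_on_coord n U 0 i.
have cV : Cn_on n U (fun q => (axis_dist t q)^-1).
  apply: Cn_onV => // [x /Uoff /axis_dist_gt0 /gt_eqF -> //|].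
  exact: Cn_on_axis_dist.
have c1 := Cn_onD oU (cc 1) (Cn_on_cst n U (- t)).
apply: Cn_on_eq (Cn_onD oU (Cn_onD oU
  (Cn_onZl (lmul_mx (delta_mx 0 1)) oU (Cn_onM oU c1 cV))
  (Cn_onZl (lmul_mx (delta_mx 0 2)) oU (Cn_onM oU (cc 2) cV)))
  (Cn_onZl (lmul_mx (delta_mx 0 3)) oU (Cn_onM oU (cc 3) cV))) => // q _.
by rewrite /slice_J [RHS]lmul_mx_sum /slice_unit !mkquatE scale0r add0r.
Qed.

Lemma Cn_on_slice_chart n U : open U -> U `<=` @off_plane R ->
  Cn_on n U (slice_chart t).
Proof.
move=> oU Uoff; have cc i := Cn_on_coord n U 0 i.
have cd := Cn_on_axis_dist n oU Uoff.
have c1 := Cn_onD oU (cc 1) (Cn_on_cst n U (- t)).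
have cV : Cn_on n U (fun q => (axis_dist t q + (q 0 1 - t))^-1).
  apply: Cn_onV => // [x /Uoff /chart_den_gt0 /gt_eqF -> //|].
  exact: Cn_onD.
by apply: Cn_on_mkquat => //; apply: Cn_onM.
Qed.

Lemma Cn_on_slice_chart_inv n U : open U -> Cn_on n U (slice_chart_inv t).
Proof.
move=> oU; have cc i := Cn_on_coord n U 0 i.
have cs := Cn_onD oU (Cn_onM oU (cc 2) (cc 2)) (Cn_onM oU (cc 3) (cc 3)).
have c1 := Cn_on_cst n U (1 : R).
have cV : Cn_on n U (fun y => (1 + (y 0 2 ^+ 2 + y 0 3 ^+ 2))^-1).
  apply: Cn_onV => // [x _|]; first by rewrite gt_eqF// chart_inv_den_gt0.
  exact: Cn_onD.
have c2 := Cn_onM oU (Cn_on_cst n U (2 : R)) (cc 1).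
apply: Cn_on_mkquat => //; last 2 first.
- by apply: Cn_onM => //; apply: Cn_onM.
- by apply: Cn_onM => //; apply: Cn_onM.
apply: Cn_onD => //; first exact: Cn_on_cst.
by apply: Cn_onM => //; apply: Cn_onM => //; apply: Cn_onD => //; exact: Cn_onN.
Qed.

End Slice.

Section SliceOCS.
Context {R : realType} (t : R).
Implicit Types (q v w y : quat R) (U : set (quat R)).

Lemma open_off_plane : open (@off_plane R).
Proof.
have -> : @off_plane R = (fun q => q 0 2) @^-1` [set x | x != 0]
    `|` (fun q => q 0 3) @^-1` [set x | x != 0] by [].
by apply: openU; apply: open_comp; [move=> ? _; exact: coord_continuous|
  exact: open_neq|move=> ? _; exact: coord_continuous|exact: open_neq].
Qed.

Lemma is_derive_coord q v i : is_derive q v (fun x : quat R => x 0 i : R) (v 0 i).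
Proof.
apply: DeriveDef; last exact: derive_coord.
exact/diff_derivable/differentiable_coord.
Qed.

Lemma is_derive_axis_dist q v : off_plane q ->
  is_derive q v (axis_dist t)
    (((q 0 1 - t) * v 0 1 + q 0 2 * v 0 2 + q 0 3 * v 0 3) / axis_dist t q).
Proof.
move=> qU; have cc i := is_derive_coord q v i.
have c1 : is_derive q v (fun x : quat R => x 0 1 - t : R) (v 0 1 - 0).
  exact: is_deriveB (cc 1) (is_derive_cst t q v).
have := is_deriveD (is_deriveD (is_deriveM c1 c1) (is_deriveM (cc 2) (cc 2)))
  (is_deriveM (cc 3) (cc 3)).
rewrite (_ : _ + _ + _ = (fun x : quat R =>
  (x 0 1 - t) ^+ 2 + x 0 2 ^+ 2 + x 0 3 ^+ 2 : R))// => -[_ dfE].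
have [dd _] := Cn_on_axis_sqr t 1 open_off_plane.
apply: is_derive_eq (is_derive_sqrt v (axis_sqr_gt0 t qU) (dd q qU)) _.
rewrite dfE -/(axis_dist t q) /GRing.scale /=.
by field; rewrite gt_eqF// axis_dist_gt0.
Qed.

Lemma derive_slice_chart q v : off_plane q ->
  let n := axis_dist t q in
  let m := n + (q 0 1 - t) in
  let dn := ((q 0 1 - t) * v 0 1 + q 0 2 * v 0 2 + q 0 3 * v 0 3) / n in
  'D_v (slice_chart t) q =
    mkquat (v 0 0) dn ((v 0 2 * m - q 0 2 * (dn + v 0 1)) / m ^+ 2)
      ((v 0 3 * m - q 0 3 * (dn + v 0 1)) / m ^+ 2).
Proof.
move=> qU n m dn; have cc i := is_derive_coord q v i.
have [dchart _] := Cn_on_slice_chart t 1 open_off_plane (@subset_refl _ _).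
have dN := is_derive_axis_dist v qU.
have m0 : m != 0 by rewrite gt_eqF// chart_den_gt0.
have c1 : is_derive q v (fun x : quat R => x 0 1 - t : R) (v 0 1 - 0).
  exact: is_deriveB (cc 1) (is_derive_cst t q v).
have dM : is_derive q v (fun x => axis_dist t x + (x 0 1 - t)) (dn + (v 0 1 - 0)).
  exact: is_deriveD dN c1.
have dQ i : is_derive q v (fun x => x 0 i / (axis_dist t x + (x 0 1 - t)))
    ((v 0 i * m - q 0 i * (dn + v 0 1)) / m ^+ 2).
  have dV : is_derive q v (fun x => (axis_dist t x + (x 0 1 - t))^-1)
      (- m ^- 2 *: (dn + (v 0 1 - 0))).
    have [dMq <-] := dM.
    split; [exact: (@derivableV _ _ (fun x => axis_dist t x + (x 0 1 - t))) |
      exact: (@deriveV _ _ (fun x => axis_dist t x + (x 0 1 - t)))].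
  have [dQ dQE] := is_deriveM (cc i) dV.
  apply: DeriveDef; first exact: dQ.
  apply: etrans dQE _.
  by rewrite /GRing.scale /= subr0 -/n -/m; field.
rewrite derive_mx; last exact: diff_derivable (dchart q qU).
apply/rowP => j; rewrite !mxE.
have -> : (fun x => slice_chart t x 0 j) = (fun x => [:: x 0 0; axis_dist t x;
    x 0 2 / (axis_dist t x + (x 0 1 - t));
    x 0 3 / (axis_dist t x + (x 0 1 - t))]`_j).
  by apply/funext => x; rewrite mxE.
by case: j => -[|[|[|[|//]]]] ? /=; exact: derive_val.
Qed.

(** Let [I] be the unit of [q]. In the half plane through [q] spanned by [1]
    and [I], left multiplication by [I] is multiplication by [i] on the first
    complex coordinate. The remaining directions are tangent to the sphere of
    units at [I], where it is the rotation by a right angle; stereographic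
    projection from [- i] turns that into multiplication by [i]. *)
Lemma slice_chart_holomorphic q v : off_plane q ->
  'D_(v *m slice_J t q) (slice_chart t) q = mulI_C2 ('D_v (slice_chart t) q).
Proof.
move=> qU; rewrite !derive_slice_chart// mul_lmul_mx /slice_unit /qmul.
rewrite /mulI_C2 !mkquatE.
have m0 := gt_eqF (chart_den_gt0 t qU); have n0 := gt_eqF (axis_dist_gt0 t qU).
have := axis_distE t q; set n := axis_dist _ _; set m := n + _ => n2.
have q1E : q 0 1 - t = m - n by rewrite /m; ring.
(* Again the square root is eliminated in favour of n and m. *)
have q2E : q 0 2 ^+ 2 = m * (2 * n - m) - q 0 3 ^+ 2.
  apply/(addrI ((q 0 1 - t) ^+ 2)).
  have -> : q 0 2 ^+ 2 = n ^+ 2 - (q 0 1 - t) ^+ 2 - q 0 3 ^+ 2.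
    by rewrite n2; ring.
  rewrite q1E; ring.
rewrite q1E.
apply: quatP; rewrite !mkquatE.
- by field: q2E; rewrite n0.
- by field: q2E; rewrite n0.
- by field: q2E; rewrite n0 m0.
- by field: q2E; rewrite n0 m0.
Qed.

(** [slice_chart_inv] is defined and continuous everywhere, so this exhibits the
    image as an open set. *)
Lemma slice_chart_image U : U `<=` @off_plane R ->
  slice_chart t @` U = [set y : quat R | 0 < y 0 1] `&` slice_chart_inv t @^-1` U.
Proof.
move=> Uoff; apply/seteqP; split=> [_ [q qU <-]|y [y1 yU]].
  split; last by rewrite /= slice_chartK//; exact: Uoff.
  by rewrite /= /slice_chart mkquatE; apply/axis_dist_gt0/Uoff.
by exists (slice_chart_inv t y) => //; exact: slice_chart_invK.
Qed.

Lemma slice_J_OCS U : open U -> U `<=` @off_plane R -> OCS U (slice_J t).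
Proof.
move=> oU Uoff; have p0 q : slice_unit t q 0 0 = 0 by rewrite mkquatE.
have J2 q : U q -> slice_J t q *m slice_J t q = - 1%:M.
  by move=> /Uoff qU; apply: lmul_mx_sqr => //; exact: slice_unit_norm.
split=> //.
- by move=> n; exact: Cn_on_slice_J.
- by move=> q qU; rewrite /slice_J lmul_mx_tr// mulmxN J2// opprK.
- move=> q _ v w; rewrite unitmxE unitfE /slice_J det_complex_frame// => d0.
  by rewrite lt_neqAle eq_sym d0 !addr_ge0// sqr_ge0.
move=> x Ux; exists U, (slice_chart t); split=> //.
have oI : open (slice_chart t @` U).
  rewrite slice_chart_image//; apply: openI.
    apply: (@open_comp _ _ (fun y : quat R => y 0 1) [set z | 0 < z]).
      by move=> ? _; exact: coord_continuous.
    exact: open_gt.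
  apply: open_comp => // y _.
  by have := @Cn_on_slice_chart_inv _ t 0 setT openT; exact.
split=> //.
- by move=> n; exact: Cn_on_slice_chart.
- exists (slice_chart_inv t) => [n|y /Uoff]; last exact: slice_chartK.
  exact: Cn_on_slice_chart_inv.
- by move=> q v /Uoff; exact: slice_chart_holomorphic.
Qed.

End SliceOCS.

(** The image of [1] under left multiplication by a unit is that unit. *)
Lemma slice_J_row0 (R : realType) (t : R) (q : quat R) k :
  slice_J t q 0 k = slice_unit t q 0 k.
Proof.
suff e : qmul (slice_unit t q) (delta_mx 0 0) = slice_unit t q.
  by rewrite [LHS]mxE e.
by apply: quatP; rewrite !(mkquatE, mxE) /=; ring.
Qed.

(** The [j]- and [k]-components of the two units have the same numerators, not
    both zero, and positive denominators. So the units are not opposite, and if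
    they are equal then so are the denominators, hence also [q1 - s] and
    [q1 - t]. *)
Lemma slice_J_independent (R : realType) (U : set (quat R)) (s t : R) :
  U `<=` @off_plane R -> s != t -> strongly_independent U (slice_J s) (slice_J t).
Proof.
move=> Uoff st q /Uoff qU.
have s0 := axis_dist_gt0 s qU; have t0 := axis_dist_gt0 t qU.
split=> /matrixP eqJ.
  have := (eqJ 0 1, eqJ 0 2, eqJ 0 3); rewrite !slice_J_row0 !mkquatE => -[[e1 e2] e3].
  have es : axis_dist s q = axis_dist t q.
    by case: qU => /mulfI h; apply: invr_inj; apply: h.
  move: e1; rewrite es => /(mulIf (invr_neq0 (lt0r_neq0 t0)))/addrI/oppr_inj.
  by apply/eqP.
have rowN k : (- slice_J t q) 0 k = - slice_unit t q 0 k by rewrite mxE slice_J_row0.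
have := (eqJ 0 2, eqJ 0 3); rewrite !rowN !slice_J_row0 !mkquatE -!mulrN => -[e2 e3].
have es : (axis_dist s q)^-1 = - (axis_dist t q)^-1 by case: qU => /mulfI; apply.
have : 0 < (axis_dist s q)^-1 by rewrite invr_gt0.
by rewrite es oppr_gt0 invr_lt0 ltNge ltW.
Qed.

(** * Cubic polynomials over a closed field *)

Lemma card_set_seq (T : choiceType) (s : seq T) n :
  ([set` s] #= `I_n)%card <-> size (undup s) = n.
Proof.
rewrite -card_fseq; have -> : [set` s] = [set` [fset x in s]%fset].
  by apply/seteqP; split=> x /=; rewrite inE.
by split=> /card_eq_fsetP.
Qed.

Section Cubics.
Context {F : closedFieldType}.

Definition cubic_disc (A B C D : F) : F :=
  B ^+ 2 * C ^+ 2 - 4 * A * C ^+ 3 - 4 * B ^+ 3 * D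
  - 27 * A ^+ 2 * D ^+ 2 + 18 * A * B * C * D.

Lemma cubic_split (A B C D : F) : A != 0 -> exists t1 t2 t3,
  [/\ B = - A * (t1 + t2 + t3), C = A * (t1 * t2 + t1 * t3 + t2 * t3)
    & D = - A * (t1 * t2 * t3)].
Proof.
move=> A0; pose p := Poly [:: D; C; B; A].
have pE : p = [:: D; C; B; A] :> seq F by rewrite /p (@PolyK _ 0).
have [r] := closed_field_poly_normal p.
have -> : lead_coef p = A by rewrite /lead_coef pE.
move=> pr.
have /eqP : size p = (size r).+1.
  by rewrite {1}pr size_scale// size_prod_XsubC.
rewrite pE /= eqSS; case: r pr => [|t1 [|t2 [|t3 [|? ?]]]] //= pr _.
have pr' : p = A *: (('X - t1%:P) * (('X - t2%:P) * ('X - t3%:P))).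
  by rewrite pr !big_cons big_nil mulr1.
have eqc i : p`_i = [:: - A * (t1 * t2 * t3);
    A * (t1 * t2 + t1 * t3 + t2 * t3); - A * (t1 + t2 + t3); A]`_i.
  suff -> : p = Poly [:: - A * (t1 * t2 * t3);
      A * (t1 * t2 + t1 * t3 + t2 * t3); - A * (t1 + t2 + t3); A].
    by rewrite (@PolyK _ 0).
  by rewrite pr' /= !cons_poly_def -!mul_polyC !(rmorphM, rmorphD, rmorphN) /=; ring.
exists t1, t2, t3; have := (eqc 0%N, eqc 1%N, eqc 2%N); rewrite pE /=.
by case=> -[-> ->] ->.
Qed.

Lemma cubic_factor (A t1 t2 t3 t : F) :
  A * t ^+ 3 + - A * (t1 + t2 + t3) * t ^+ 2
  + A * (t1 * t2 + t1 * t3 + t2 * t3) * t + - A * (t1 * t2 * t3)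
  = A * ((t - t1) * (t - t2) * (t - t3)).
Proof. by ring. Qed.

Lemma cubic_disc_roots (A t1 t2 t3 : F) :
  cubic_disc A (- A * (t1 + t2 + t3)) (A * (t1 * t2 + t1 * t3 + t2 * t3))
    (- A * (t1 * t2 * t3))
  = (A ^+ 2 * ((t1 - t2) * (t1 - t3) * (t2 - t3))) ^+ 2.
Proof. by rewrite /cubic_disc; ring. Qed.

Lemma cubic_roots_card (A B C D : F) : A != 0 ->
  ([set t | (A * t ^+ 3 + B * t ^+ 2 + C * t + D)%R = 0] #= `I_3)%card
  <-> cubic_disc A B C D != 0.
Proof.
move=> A0; have [t1 [t2 [t3 [-> -> ->]]]] := cubic_split B C D A0.
rewrite cubic_disc_roots.
have -> : [set t | (A * t ^+ 3 + - A * (t1 + t2 + t3) * t ^+ 2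
    + A * (t1 * t2 + t1 * t3 + t2 * t3) * t + - A * (t1 * t2 * t3))%R = 0]
    = [set` [:: t1; t2; t3]].
  apply/seteqP; split=> t /=; rewrite cubic_factor !inE.
    move=> /eqP; rewrite !mulf_eq0 (negPf A0) !subr_eq0 /= -orbA.
    by [].
  move=> h; apply/eqP; rewrite !mulf_eq0 (negPf A0) !subr_eq0 /= -orbA.
  by [].
rewrite card_set_seq expf_eq0 /= !mulf_eq0 ?expf_eq0 (negPf A0) /= !subr_eq0.
have -> : (size (undup [:: t1; t2; t3]) = 3%N) <-> uniq [:: t1; t2; t3].
  split=> [h|/undup_id -> //].
  by have := ltn_size_undup [:: t1; t2; t3]; rewrite h /= ltnn => /esym/negbFE.
by rewrite /= !inE andbT -!negb_or.
Qed.

End Cubics.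

(** * The fibres of the twistor fibration and the cubic *)

Section Fibre.
Context {R : realType}.
Implicit Types (q : quat R) (x y t : R[i]).

(** Conjugation with its components exposed, so that its continuity is read off. *)
Definition cconj (z : R[i]) : R[i] := complex.Re z -i* complex.Im z.

Lemma cconj_eq0 (z : R[i]) : (cconj z == 0) = (z == 0).
Proof. by case: z => a b; rewrite /cconj !eq_complex /= oppr_eq0. Qed.

(** [q = qa q + qb q * j], the product being that of quaternions. *)
Definition qa q : R[i] := (q 0 0) +i* (q 0 1).
Definition qb q : R[i] := (q 0 2) +i* (q 0 3).

Definition scroll_fibre q : set (CP3 R) :=
  @twistor R @^-1` [set hp1_affine q] `&` @cubic_scroll R.

(** The solutions of [X2 + X3 j = (X0 + X1 j) q], parametrized by [X0] and [X1]. *)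
Definition fibre_vec q x y : 'rV[R[i]]_4 :=
  \row_(j < 4) [:: x; y; qa q * x - cconj (qb q) * y; qb q * x + cconj (qa q) * y]`_j.

Lemma row4P (S : Type) (u v : 'rV[S]_4) : u 0 0 = v 0 0 -> u 0 1 = v 0 1 ->
  u 0 2 = v 0 2 -> u 0 3 = v 0 3 -> u = v.
Proof.
move=> h0 h1 h2 h3; apply/rowP => -[[|[|[|[|//]]]] lt4];
  [move: h0|move: h1|move: h2|move: h3];
  by congr (u _ _ = v _ _); apply: val_inj.
Qed.

Lemma qmulq1 (p : quat R) : qmul p (qone R) = p.
Proof. by apply: quatP; rewrite /qmul /qone !mkquatE; ring. Qed.

Lemma fibre_vecE q x y : twistor_vec (fibre_vec q x y) =
  (quatC x y, qmul (quatC x y) q).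
Proof.
rewrite /twistor_vec !mxE /=; congr pair.
case: x y => [x x'] [y y'].
by apply: quatP; rewrite /quatC /qmul !mkquatE /=; ring.
Qed.

Lemma quatC_inj (x y z w : R[i]) : quatC x y = quatC z w -> x = z /\ y = w.
Proof.
case: x y z w => [x x'] [y y'] [z z'] [w w'] /rowP e.
by have := (e 0, e 1, e 2, e 3); rewrite /quatC !mkquatE /= => -[[[-> ->] ->] ->].
Qed.

Lemma twistor_affineP q (X : cvec R) :
  twistor (\pi_(CP3 R)%qT X) = hp1_affine q <->
  val X = fibre_vec q (val X 0 0) (val X 0 1).
Proof.
have X0 := valP X; rewrite twistor_pi; split=> [/esym/eqmodP/asboolP[p p0 /=]|XE].
  rewrite qmulq1 /twistor_vec => -[<-].
  have := fibre_vecE q (val X 0 0) (val X 0 1); rewrite /twistor_vec => -[_ <-].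
  move=> /quatC_inj[e2 e3]; apply: row4P => //; by rewrite !mxE.
apply/esym/eqmodP/asboolP => /=; exists (quatC (val X 0 0) (val X 0 1)).
  apply: contra_neq X0 => /quatC_eq0[x0 y0].
  by rewrite XE x0 y0; apply: row4P; rewrite !mxE //= !mulr0 ?subr0 ?addr0.
by rewrite qmulq1 [in LHS]XE fibre_vecE.
Qed.

Lemma cubic_scrollP (X : cvec R) : cubic_scroll (\pi_(CP3 R)%qT X) <->
  (val X) 0 0 * (val X) 0 3 ^+ 2 + (val X) 0 1 ^+ 2 * (val X) 0 2 = 0.
Proof.
split=> [[Y Y0 /eqmodP/asboolP[a a0 ->]]|X0]; last by exists X.
rewrite !mxE; have -> : forall z0 z1 z2 z3 : R[i], a * z0 * (a * z3) ^+ 2 +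
  (a * z1) ^+ 2 * (a * z2) = a ^+ 3 * (z0 * z3 ^+ 2 + z1 ^+ 2 * z2).
  by move=> *; ring.
by rewrite Y0 mulr0.
Qed.


(** The equation of the cubic restricted to the twistor line over [q]. *)
Definition fibre_form q x y : R[i] :=
  x * (qb q * x + cconj (qa q) * y) ^+ 2 + y ^+ 2 * (qa q * x - cconj (qb q) * y).

Lemma fibre_vec1_neq0 q t : fibre_vec q 1 t != 0.
Proof.
apply/eqP => /rowP /(_ 0); rewrite !mxE /= => /eqP; by rewrite oner_eq0.
Qed.

Lemma fibre_vec_infty_neq0 q : fibre_vec q 0 1 != 0.
Proof.
apply/eqP => /rowP /(_ 1); rewrite !mxE /= => /eqP; by rewrite oner_eq0.
Qed.

Definition fibre_pt q t : CP3 R :=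
  \pi_(CP3 R)%qT (exist _ (fibre_vec q 1 t) (fibre_vec1_neq0 q t)).

Definition fibre_infty q : CP3 R :=
  \pi_(CP3 R)%qT (exist _ (fibre_vec q 0 1) (fibre_vec_infty_neq0 q)).

Lemma fibre_pt_inj q : injective (fibre_pt q).
Proof.
move=> s t /eqmodP/asboolP[a a0 /=] /rowP e.
have := (e 0, e 1); rewrite !mxE /= mulr1 => -[<-].
by rewrite mul1r => ->.
Qed.

Lemma fibre_ptP q t : scroll_fibre q (fibre_pt q t) <-> fibre_form q 1 t = 0.
Proof.
split=> [[_ /cubic_scrollP]|e]; first by rewrite /= !mxE.
split; first by apply/twistor_affineP; rewrite /= !mxE.
by apply/cubic_scrollP; rewrite /= !mxE.
Qed.

(** The point at infinity of the line lies on the cubic only if the coefficient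
    of [y ^ 3] in [fibre_form], minus the conjugate of [qb q], vanishes. *)
Lemma scroll_fibreE q : scroll_fibre q `<=`
  (fibre_pt q @` [set t | fibre_form q 1 t = 0]) `|`
  [set x | x = fibre_infty q /\ qb q = 0].
Proof.
move=> p; elim/quotW: p => X [/twistor_affineP XE /cubic_scrollP cX].
set x := val X 0 0 in XE; set y := val X 0 1 in XE.
have : fibre_form q x y = 0 by rewrite -cX XE !mxE.
have [x0|x0] := eqVneq x 0; last first.
  move=> e; have e1 : fibre_form q 1 (y / x) = 0.
    have -> : fibre_form q 1 (y / x) = fibre_form q x y / x ^+ 3.
      by rewrite /fibre_form; field.
    by rewrite e mul0r.
  left; exists (y / x) => //.
  apply/eqmodP/asboolP; exists x => //=; rewrite XE.
  by apply: row4P; rewrite !mxE /=; field.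
rewrite x0 in XE *.
have y0 : y != 0.
  apply: contra_neq (valP X) => y0; rewrite XE y0.
  by apply: row4P; rewrite !mxE //= !mulr0 ?subr0 ?addr0.
rewrite /fibre_form => e; right; split.
  apply/esym/eqmodP/asboolP; exists y => //=; rewrite XE.
  by apply: row4P; rewrite !mxE /=; ring.
have : - y ^+ 3 * cconj (qb q) = 0 by rewrite -e; ring.
move/eqP; rewrite mulf_eq0 oppr_eq0 expf_eq0 (negPf y0) /= cconj_eq0.
by move/eqP.
Qed.

(** The discriminant of [fibre_form q 1 t] as a cubic in [t]; for [qb q = 0] the
    cubic has degree at most 2 and the formula gives 0. *)
Definition scroll_disc q : R[i] :=
  cubic_disc (- cconj (qb q)) (qa q + cconj (qa q) ^+ 2) (2 * cconj (qa q) * qb q)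
    (qb q ^+ 2).

Lemma fibre_formE q t : fibre_form q 1 t =
  - cconj (qb q) * t ^+ 3 + (qa q + cconj (qa q) ^+ 2) * t ^+ 2
  + 2 * cconj (qa q) * qb q * t + qb q ^+ 2.
Proof. by rewrite /fibre_form; ring. Qed.

Lemma scroll_disc_plane q : qb q = 0 -> scroll_disc q = 0.
Proof.
move=> b0; have bc0 : cconj (qb q) = 0 by apply/eqP; rewrite cconj_eq0 b0.
by rewrite /scroll_disc /cubic_disc bc0 b0; ring.
Qed.

(** Off the plane the points of the fibre are the roots of a genuine cubic. In
    the plane [fibre_form q x y] is a multiple of [x * y ^ 2], so the fibre is
    infinite or has at most two points. *)
Lemma scroll_domainP q : scroll_domain q <-> scroll_disc q != 0.
Proof.
have -> : scroll_domain q <-> (scroll_fibre q #= `I_3)%card.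
  by rewrite /scroll_domain /Disc /=; split=> [/contrapT //|h]; exact.
have [b0|b0] := eqVneq (qb q) 0; last first.
  have bc0 : - cconj (qb q) != 0 by rewrite oppr_eq0 cconj_eq0.
  rewrite -cubic_roots_card//; set roots := [set t : R[i] | _].
  suff -> : scroll_fibre q = fibre_pt q @` roots.
    by rewrite (card_eql (inj_card_eq (in2W (@fibre_pt_inj q)))).
  apply/seteqP; split=> [p /scroll_fibreE[[t e <-]|[_ /eqP]]|_ [t e <-]].
  - by exists t => //; rewrite /roots /= -fibre_formE.
  - by rewrite (negPf b0).
  - by apply/fibre_ptP; rewrite fibre_formE.
have bc0 : cconj (qb q) = 0 by apply/eqP; rewrite cconj_eq0 b0.
rewrite scroll_disc_plane// eqxx; split=> // card3; exfalso.
have form0 t : fibre_form q 1 t = (qa q + cconj (qa q) ^+ 2) * t ^+ 2.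
  by rewrite fibre_formE bc0 b0; ring.
have [c0|c0] := eqVneq (qa q + cconj (qa q) ^+ 2) 0.
  pose f n := fibre_pt q n%:R.
  apply: infinite_nat.
  have <- : f @^-1` scroll_fibre q = setT.
    apply/seteqP; split=> // n _; apply/fibre_ptP.
    by rewrite form0 c0 mul0r.
  apply: finite_preimage; last by apply/finite_setP; exists 3%N.
  move=> m n _ _ /fibre_pt_inj/eqP; by rewrite eqr_nat => /eqP.
pose s := [:: fibre_pt q 0; fibre_infty q].
have sub : scroll_fibre q `<=` [set` s].
  move=> p /scroll_fibreE[[t e <-]|[-> _]]; rewrite /= !inE ?eqxx ?orbT//.
  move: e => /eqP; rewrite /= form0 mulf_eq0 (negPf c0) expf_eq0 /= => /eqP ->.
  by rewrite eqxx.
have card_s : ([set` s] #= `I_(size (undup s)))%card by apply/card_set_seq.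
suff : (`I_3 #<= `I_(size (undup s)))%card.
  by rewrite card_le_II leqNgt ltnS (size_undup s).
rewrite -(card_le_eqr card_s) -(card_le_eql card3).
exact: subset_card_le.
Qed.

End Fibre.

(** * The domain *)

Section ComplexContinuity.
Context {R : realType} {T : topologicalType}.
Implicit Types f g : T -> R[i].

Definition ccontinuous f : Prop :=
  continuous (fun q => complex.Re (f q)) /\ continuous (fun q => complex.Im (f q)).

Lemma ccontinuous_cst (z : R[i]) : ccontinuous (fun=> z).
Proof. by split=> q; exact: cst_continuous. Qed.

Lemma ccontinuousD f g : ccontinuous f -> ccontinuous g ->
  ccontinuous (fun q => f q + g q).
Proof.
move=> [fr fi] [gr gi]; split.
  rewrite (_ : (fun q => _) = (fun q => complex.Re (f q) + complex.Re (g q))).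
    by move=> q; apply: cvgD; [exact: fr|exact: gr].
  by apply/funext => q; case: (f q) (g q) => [? ?] [? ?].
rewrite (_ : (fun q => _) = (fun q => complex.Im (f q) + complex.Im (g q))).
  by move=> q; apply: cvgD; [exact: fi|exact: gi].
by apply/funext => q; case: (f q) (g q) => [? ?] [? ?].
Qed.

Lemma ccontinuousM f g : ccontinuous f -> ccontinuous g ->
  ccontinuous (fun q => f q * g q).
Proof.
move=> [fr fi] [gr gi]; split.
  rewrite (_ : (fun q => _) = (fun q => complex.Re (f q) * complex.Re (g q)
      - complex.Im (f q) * complex.Im (g q))).
    by move=> q; apply: cvgB; apply: cvgM;
      by [exact: fr|exact: gr|exact: fi|exact: gi].
  by apply/funext => q; case: (f q) (g q) => [? ?] [? ?].
rewrite (_ : (fun q => _) = (fun q => complex.Re (f q) * complex.Im (g q)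
    + complex.Im (f q) * complex.Re (g q))).
  by move=> q; apply: cvgD; apply: cvgM;
    by [exact: fr|exact: gr|exact: fi|exact: gi].
by apply/funext => q; case: (f q) (g q) => [? ?] [? ?].
Qed.

Lemma ccontinuousN f : ccontinuous f -> ccontinuous (fun q => - f q).
Proof.
move=> /(ccontinuousM (ccontinuous_cst (-1))).
by under eq_fun do rewrite mulN1r.
Qed.

Lemma ccontinuousX f n : ccontinuous f -> ccontinuous (fun q => f q ^+ n).
Proof.
move=> cf; elim: n => [|n IHn]; first exact: ccontinuous_cst.
by under eq_fun do rewrite exprS; exact: ccontinuousM.
Qed.

Lemma ccontinuous_conj f : ccontinuous f -> ccontinuous (fun q => cconj (f q)).
Proof. by move=> [fr fi]; split=> // q; apply: cvgN; exact: fi. Qed.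

Lemma ccontinuous_cubic_disc (A B C D : T -> R[i]) :
  ccontinuous A -> ccontinuous B -> ccontinuous C -> ccontinuous D ->
  ccontinuous (fun q => cubic_disc (A q) (B q) (C q) (D q)).
Proof.
move=> cA cB cC cD; pose k n := ccontinuous_cst (n%:R : R[i]).
have M := ccontinuousM; have X := ccontinuousX.
have S f g (cf : ccontinuous f) (cg : ccontinuous g) :=
  ccontinuousD cf (ccontinuousN cg).
exact: ccontinuousD (S _ _ (S _ _ (S _ _ (M _ _ (X _ 2%N cB) (X _ 2%N cC))
  (M _ _ (M _ _ (k 4%N) cA) (X _ 3%N cC)))
  (M _ _ (M _ _ (k 4%N) (X _ 3%N cB)) cD))
  (M _ _ (M _ _ (k 27%N) (X _ 2%N cA)) (X _ 2%N cD)))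
  (M _ _ (M _ _ (M _ _ (M _ _ (k 18%N) cA) cB) cC) cD).
Qed.

End ComplexContinuity.

Lemma complex_neq0P (R : realType) (z : R[i]) :
  z != 0 <-> complex.Re z != 0 \/ complex.Im z != 0.
Proof. by case: z => x y; rewrite eq_complex negb_and; split=> /orP. Qed.

Section ScrollDomain.
Context {R : realType}.
Implicit Types q : quat R.

Lemma ccontinuous_disc : ccontinuous (@scroll_disc R).
Proof.
have ca : ccontinuous (@qa R) by split=> q; exact: coord_continuous.
have cb : ccontinuous (@qb R) by split=> q; exact: coord_continuous.
have ca' := ccontinuous_conj ca; have cb' := ccontinuous_conj cb.
exact: ccontinuous_cubic_disc (ccontinuousN cb')
  (ccontinuousD ca (ccontinuousX 2 ca'))
  (ccontinuousM (ccontinuousM (ccontinuous_cst 2) ca') cb) (ccontinuousX 2 cb).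
Qed.

Lemma open_scroll_domain : open (@scroll_domain R).
Proof.
have [cr ci] := ccontinuous_disc.
have -> : @scroll_domain R =
    (fun q => complex.Re (scroll_disc q)) @^-1` [set x | x != 0]
    `|` (fun q => complex.Im (scroll_disc q)) @^-1` [set x | x != 0].
  by apply/seteqP; split=> q; [move=> /scroll_domainP /complex_neq0P|
    move=> /complex_neq0P /scroll_domainP].
by apply: openU; apply: open_comp; [move=> ? _; exact: cr|exact: open_neq|
  move=> ? _; exact: ci|exact: open_neq].
Qed.

Lemma scroll_domain_off_plane : @scroll_domain R `<=` @off_plane R.
Proof.
move=> q /scroll_domainP; have [b0|b0 _] := eqVneq (qb q) 0.
  by rewrite scroll_disc_plane// eqxx.
by case/complex_neq0P: b0; [left|right].
Qed.

(** At [e j] with [e = 1] or [e = - 1] the cubic is [1 - e * t ^ 3]. *)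
Lemma scroll_domain_j (e : R) : e ^+ 2 = 1 -> scroll_domain (mkquat 0 0 e 0).
Proof.
move=> e1; apply/scroll_domainP.
have a0 : qa (mkquat 0 0 e 0) = 0 by rewrite /qa !mkquatE.
have ac0 : cconj (qa (mkquat 0 0 e 0)) = 0 by apply/eqP; rewrite cconj_eq0 a0.
have bE : qb (mkquat 0 0 e 0) = e%:C by rewrite /qb !mkquatE.
have bcE : cconj (qb (mkquat 0 0 e 0)) = e%:C.
  by rewrite bE /cconj /= oppr0.
have ec : (e%:C : R[i]) ^+ 2 = 1 by rewrite -rmorphXn /= e1.
rewrite /scroll_disc /cubic_disc ac0 a0 bcE bE ec.
have -> : forall z : R[i], z ^+ 2 = 1 -> (0 + 0 ^+ 2) ^+ 2 * (2 * 0 * z) ^+ 2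
  - 4 * - z * (2 * 0 * z) ^+ 3 - 4 * (0 + 0 ^+ 2) ^+ 3 * 1
  - 27 * (- z) ^+ 2 * 1 ^+ 2 + 18 * - z * (0 + 0 ^+ 2) * (2 * 0 * z) * 1
  = - 27%:R :> R[i].
  by move=> z z1; ring: z1.
- by rewrite oppr_eq0 pnatr_eq0.
exact: ec.
Qed.

(** The points [j] and [- j] are at the same distance from the axis, but the
    [j]-components of their units are opposite. *)
Lemma slice_J_nonconstant (t : R) : ~ constant_on (@scroll_domain R) (slice_J t).
Proof.
move=> [A JA]; pose q e : quat R := mkquat 0 0 e 0.
have e1 : (1 : R) ^+ 2 = 1 by rewrite expr1n.
have eN1 : (-1 : R) ^+ 2 = 1 by rewrite sqrrN expr1n.
have := JA _ (scroll_domain_j eN1); rewrite -(JA _ (scroll_domain_j e1)).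
have q1 : off_plane (q 1) by left; rewrite /q mkquatE oner_eq0.
have dE : axis_dist t (q (-1)) = axis_dist t (q 1).
  by rewrite /axis_dist /q !mkquatE sqrrN.
have d0 := axis_dist_gt0 t q1.
move=> /matrixP/(_ 0 2); rewrite !slice_J_row0 /slice_unit dE !mkquatE.
move=> /(mulIf (invr_neq0 (lt0r_neq0 d0))) h.
by have := @ltr01 R; rewrite -h oppr_gt0 ltNge ler01.
Qed.

End ScrollDomain.

Theorem corollary1p7 (R : realType) :
  exists J : 'I_3 -> 'rV[R]_4 -> 'M[R]_4,
    [/\ forall a, OCS (@scroll_domain R) (J a),
        forall a, ~ constant_on (@scroll_domain R) (J a)
      & forall a b, a != b ->
          strongly_independent (@scroll_domain R) (J a) (J b)].
Proof.
exists (fun a => slice_J a%:R); split=> [a|a|a b ab].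
- exact: slice_J_OCS open_scroll_domain scroll_domain_off_plane.
- exact: slice_J_nonconstant.
- by apply: slice_J_independent; [exact: scroll_domain_off_plane|
    rewrite eqr_nat].
Qed.
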